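(* Let $(W,S)$ be a Coxeter system. For each finitary subset $I\subset S$, there is a bijection $${}_I\mathcal{SC}^{\mathrm{core}}(W,S)\longrightarrow\mathsf{Cham}(W,S,I)$$ sending a core $(I,J)$-coset $p$ to the chamber $p(C_J)$.
   Context: For $I\subset S$, $W_I$ is the subgroup generated by $I$; $I$ is finitary if $W_I$ is finite. For finitary $I,J$, an $(I,J)$-coset is an element $p\in W_I\backslash W/W_J$ (the pair $(I,J)$ is part of the data), with unique Bruhat-minimal element $\underline p$. It is core if $I=\underline pJ\underline p^{-1}$ (equivalently $W_Iw=W_IwW_J=wW_J$ for $w\in p$). ${}_I\mathcal{SC}^{\mathrm{core}}(W,S)$ is the set of all core $(I,J)$-cosets, where $I$ is fixed and $J\subset S$ varies over finitary subsets. Let $V$ be the geometric (standard) realization of $(W,S)$ over $\mathbb R$, with basis $\{\alpha_s\}_{s\in S}$, and let $W$ act on $V^*$ by the dual action. Let $C=\{\theta\in V^*\mid\theta(\alpha_s)>0\text{ for all }s\in S\}$ and let $\overline C$ be its closure. The Tits cone is $\mathsf{Cone}(W,S)=\bigcup_{w\in W}w(\overline C)\subset V^*$. For $I\subset S$ put $\mathsf{Cone}(W,S,I)=\mathsf{Cone}(W,S)\cap\{\theta\in V^*\mid\theta(\alpha_s)=0\text{ for }s\in I\}$. For $J\subset S$ put $C_J=\{\theta\in V^*\mid\theta(\alpha_s)>0\text{ for }s\in S\setminus J,\ \theta(\alpha_s)=0\text{ for }s\in J\}$. An $I$-chamber is a subset of $\mathsf{Cone}(W,S,I)$ of the form $w(C_J)$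 with $w\in W$ and $J\subset S$, $|J|=|I|$; $\mathsf{Cham}(W,S,I)$ is the set of $I$-chambers. For a core $(I,J)$-coset $p$, $p(C_J):=\underline p(C_J)$ (which equals $x(C_J)$ for any $x\in p$). *)

(* Defs.v *)
From HB Require Import structures.
From Stdlib Require Import Relation_Operators.
From mathcomp Require Import all_boot all_order all_algebra finmap.
From mathcomp Require Import ring lra.
From mathcomp Require Import all_classical reals topology normedtype trigo.
From mathcomp Require Import function_spaces.
(* The notations of monalg are incompatible with those of MathComp-Analysis. *)
From mathcomp Require monalg.
Import -(notations) monalg.

Set Implicit Arguments.
Unset Strict Implicit.
Unset Printing Implicit Defensive.

Import Order.TTheory GRing.Theory Num.Theory.
Import numFieldNormedType.Exports.

Local Open Scope classical_set_scope.

(* The least element of P, or 0 if P is empty. *)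
Definition nat_min (P : set nat) : nat :=
  xget 0%N [set n | P n /\ forall k, P k -> (n <= k)%N].

Section Coxeter.
Local Open Scope group_scope.
Variable W : groupType.
Implicit Types (S I J p : set W) (w x y : W).

Definition subgroup (H : set W) : Prop :=
  [/\ H 1, (forall x y, H x -> H y -> H (x * y)) & forall x, H x -> H x^-1].

Definition gen (A : set W) : set W := smallest subgroup A.

(* The order of x, with value 0 when x has infinite order. *)
Definition gorder x : nat := nat_min [set n | (0 < n)%N /\ x ^+ n = 1].

(* The last clause is the universal property of the presentation
   < S | (st)^m(s,t) = 1 whenever m(s,t) < oo >, where m(s,t) is the order of
   st; uniqueness of h follows from the second clause. *)
Definition coxeter_system S : Prop :=
  [/\ forall s, S s -> s <> 1 /\ s * s = 1,
      gen S = [set: W]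
    & forall (G : groupType) (f : W -> G),
        (forall s t, S s -> S t -> (0 < gorder (s * t))%N ->
           (f s * f t) ^+ gorder (s * t) = 1) ->
        exists h : W -> G,
          (forall x y, h (x * y) = h x * h y) /\ (forall s, S s -> h s = f s)].

Definition finitary S I : Prop := I `<=` S /\ finite_set (gen I).

Definition length S w : nat :=
  nat_min [set n | exists u : seq W,
    [/\ size u = n, [set` u] `<=` S & w = \prod_(s <- u) s]].

Definition reflections S : set W :=
  [set t | exists w s, S s /\ t = w * s * w^-1].

Definition bruhat S : W -> W -> Prop :=
  clos_refl_trans W (fun x y =>
    exists2 t, reflections S t & y = x * t /\ (length S x < length S y)%N).

Definition double_cosets I J : set (set W) :=
  [set p | exists w, p = [set x * w * y | x in gen I & y in gen J]].

Definition min_elt S p : W :=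
  xget 1 [set x | p x /\ forall y, p y -> bruhat S y x -> y = x].

Definition core S I J p : Prop :=
  I = [set min_elt S p * s * (min_elt S p)^-1 | s in J].

(* An (I, J)-coset p remembers J, and is encoded as the pair (J, p). *)
Definition SCcore S I : set (set W * set W) :=
  [set Jp | [/\ finitary S Jp.1, double_cosets I Jp.1 Jp.2
              & core S I Jp.1 Jp.2]].

End Coxeter.

Section Geometry.
Local Open Scope ring_scope.
Variables (R : realType) (W : groupType) (S : set W).

(* The real vector space with basis S. *)
Definition geomV : Type := malg S R.
HB.instance Definition _ := GRing.Lmodule.on geomV.

Definition sroot (s : S) : geomV := mkmalgU s 1.

(* gorder (st) = 0 means m(s,t) = oo, where - cos (pi / m(s,t)) is read as -1. *)
Definition bform_coef (s t : S) : R :=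
  let m := gorder (val s * val t)%g in
  if m == 0%N then - 1 else - cos (pi / m%:R).

Definition bform (u v : geomV) : R :=
  \sum_(s <- msupp u) \sum_(t <- msupp v)
    mcoeff s u * mcoeff t v * bform_coef s t.

Definition srefl (s : S) (v : geomV) : geomV :=
  v - (2 * bform (sroot s) v) *: sroot s.

Definition geometric_rep (rho : W -> geomV -> geomV) : Prop :=
  [/\ rho 1%g = id, forall x y, rho (x * y)%g = rho x \o rho y
    & forall s : S, rho (val s) = srefl s].

(* For a Coxeter system there is exactly one such representation: see
   geom_actP and geometric_rep_uniq below. *)
Definition geom_act : W -> geomV -> geomV :=
  @xget (W -> geomV -> geomV) (fun=> id) [set rho | geometric_rep rho].

(* V^* sits inside V -> R with the topology of pointwise convergence, i.e. it
   carries the weak-* topology; for S finite this is the usual topology of a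
   finite-dimensional real vector space. *)
Definition dualV : set {ptws geomV -> R} := [set theta | scalar theta].

Definition dual_act (w : W) (theta : {ptws geomV -> R}) : {ptws geomV -> R} :=
  fun v => theta (geom_act w^-1%g v).

Definition chamberC : set {ptws geomV -> R} :=
  [set theta | dualV theta /\ forall s : S, 0 < theta (sroot s)].

Definition chamberC_closure : set {ptws geomV -> R} :=
  dualV `&` closure chamberC.

Definition Tits_cone : set {ptws geomV -> R} :=
  \bigcup_(w in [set: W]) (dual_act w @` chamberC_closure).

Definition Tits_cone_at (I : set W) : set {ptws geomV -> R} :=
  Tits_cone `&` [set theta | forall s : S, I (val s) -> theta (sroot s) = 0].

Definition faceC (J : set W) : set {ptws geomV -> R} :=
  [set theta | [/\ dualV theta,
     forall s : S, ~ J (val s) -> 0 < theta (sroot s)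
   & forall s : S, J (val s) -> theta (sroot s) = 0]].

Definition Cham (I : set W) : set (set {ptws geomV -> R}) :=
  [set X | X `<=` Tits_cone_at I /\
     exists w J, [/\ J `<=` S, (J #= I)%card & X = dual_act w @` faceC J]].

Definition coset_face (J p : set W) : set {ptws geomV -> R} :=
  dual_act (min_elt S p) @` faceC J.

End Geometry.

Record bijections (T : Type) := Bijection {
  bij_fun : T -> T;
  bij_fun_inv : T -> T;
  bij_funK : cancel bij_fun bij_fun_inv;
  bij_fun_invK : cancel bij_fun_inv bij_fun }.

HB.instance Definition _ (T : Type) := gen_eqMixin (bijections T).
HB.instance Definition _ (T : Type) := gen_choiceMixin (bijections T).

Section BijectionGroup.
Variable T : Type.
Implicit Types f g : bijections T.

Lemma bijections_ext f g : bij_fun f =1 bij_fun g -> f = g.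
Proof.
case: f g => [f1 f2 fK1 fK2] [g1 g2 gK1 gK2] /= /funext fg.
have fg2 : f2 = g2 by apply/funext => x; rewrite -{1}(gK2 x) -fg fK1.
by subst g1 g2; congr Bijection; apply: Prop_irrelevance.
Qed.

Definition bij_one := @Bijection T id id (fun=> erefl) (fun=> erefl).
Definition bij_inv f := Bijection (@bij_fun_invK T f) (@bij_funK T f).
Definition bij_mul f g := Bijection
  (can_comp (@bij_funK T f) (@bij_funK T g))
  (can_comp (@bij_fun_invK T g) (@bij_fun_invK T f)).

Let bij_mulA : associative bij_mul.
Proof. by move=> f g h; apply: bijections_ext. Qed.
Let bij_mul1 : left_id bij_one bij_mul.
Proof. by move=> f; apply: bijections_ext. Qed.
Let bij_1mul : right_id bij_one bij_mul.
Proof. by move=> f; apply: bijections_ext. Qed.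
Let bij_mulV : left_inverse bij_one bij_inv bij_mul.
Proof. by move=> f; apply: bijections_ext => x; apply: bij_funK. Qed.
Let bij_Vmul : right_inverse bij_one bij_inv bij_mul.
Proof. by move=> f; apply: bijections_ext => x; apply: bij_fun_invK. Qed.

HB.instance Definition _ := isGroup.Build (bijections T)
  bij_mulA bij_mul1 bij_1mul bij_mulV bij_Vmul.

Lemma bij_funX f n : bij_fun (f ^+ n)%g = iter n (bij_fun f).
Proof.
elim: n => [|n IHn]; first by rewrite expg0.
by rewrite expgS; apply/funext => x /=; rewrite -IHn.
Qed.

End BijectionGroup.

Section Dihedral.
Local Open Scope ring_scope.
Variables (R : realType) (V : lmodType R).
Variables (X Y : V -> R) (a b : V) (m : nat).
Hypotheses (X_lin : scalar X) (Y_lin : scalar Y) (m_gt1 : (1 < m)%N).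
Let th : R := pi / m%:R.
Let c : R := cos th.
Hypotheses (Xa : X a = 1) (Xb : X b = - c) (Ya : Y a = - c) (Yb : Y b = 1).

Let f (v : V) : V := v - (2 * Y v) *: b - (2 * X (v - (2 * Y v) *: b)) *: a.
Let sk (k : nat) : R := sin (k%:R * th).

Let XD u v k : X (u + k *: v) = X u + k * X v.
Proof. by rewrite addrC X_lin addrC. Qed.
Let YD u v k : Y (u + k *: v) = Y u + k * Y v.
Proof. by rewrite addrC Y_lin addrC. Qed.

Let comb u p q r t :
  u + p *: a + q *: b + r *: b + t *: a = u + (p + t) *: a + (q + r) *: b.
Proof.
by rewrite !scalerDl -!addrA; congr (_ + (_ + _)); rewrite addrA addrC.
Qed.

Let fE u p q : X u = 0 -> Y u = 0 ->
  f (u + p *: a + q *: b) =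
  u + ((4 * c ^+ 2 - 1) * p - 2 * c * q) *: a + (2 * c * p - q) *: b.
Proof.
move=> Xu Yu; rewrite /f -!(@scaleNr R V) !(XD, YD) Xu Yu Xa Xb Ya Yb comb.
by congr (_ + _ *: _ + _ *: _); ring.
Qed.

Let skS k : sk k.+2 = 2 * c * sk k.+1 - sk k.
Proof.
have -> : sk k.+2 = sin (k.+1%:R * th + th).
  by rewrite /sk -(natr1 k.+1); congr sin; ring.
have -> : sk k = sin (k.+1%:R * th - th) by rewrite /sk -natr1; congr sin; ring.
rewrite sinD sinB -/c /sk; ring.
Qed.

Let iter_f u p q k : X u = 0 -> Y u = 0 ->
  iter k f (u + (sk 1 * p) *: a + (sk 1 * q) *: b) =
  u + (sk k.*2.+1 * p - sk k.*2 * q) *: a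
    + (sk k.*2 * p - (2 * c * sk k.*2 - sk k.*2.+1) * q) *: b.
Proof.
move=> Xu Yu; elim: k => [|k IHk] /=.
  rewrite /sk /= mul0r sin0 mulr0 !mul0r subr0 !sub0r.
  by congr (_ + _ + _ *: _); ring.
rewrite IHk fE // doubleS !skS.
by congr (_ + _ *: _ + _ *: _); ring.
Qed.

Lemma iter_dihedral v : iter m f v = v.
Proof.
have m_gt0 : 0 < m%:R :> R by rewrite ltr0n ltnW.
have th_gt0 : 0 < th by rewrite divr_gt0 ?pi_gt0.
have th_lt : th < pi.
  by rewrite ltr_pdivrMr // ltr_pMr ?pi_gt0 // ltr1n.
have s_gt0 : 0 < sin th by apply: sin_gt0_pi; rewrite th_gt0 th_lt.
have sk1 : sk 1 = sin th by rewrite /sk mul1r.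
have D : sin th ^+ 2 = 1 - c ^+ 2 by rewrite -(cos2Dsin2 th) addrC addKr.
have D0 : 1 - c ^+ 2 != 0 by rewrite -D expf_neq0 // gt_eqF.
pose p := (X v + c * Y v) / (1 - c ^+ 2).
pose q := (Y v + c * X v) / (1 - c ^+ 2).
pose u := v + (- p) *: a + (- q) *: b.
have Xu : X u = 0 by rewrite !XD Xa Xb /p /q; field.
have Yu : Y u = 0 by rewrite !YD Ya Yb /p /q; field.
have s0 : sin th != 0 by rewrite gt_eqF.
have vE : v = u + (sk 1 * (p / sk 1)) *: a + (sk 1 * (q / sk 1)) *: b.
  rewrite sk1 ![sin th * (_ / _)]mulrC !divfK // /u.
  by rewrite !scaleNr addrAC !subrK.
have mth : m.*2%:R * th = pi *+ 2.
  by rewrite /th -muln2 natrM -mulr_natr; field; rewrite gt_eqF.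
have sk2m : sk m.*2 = 0 by rewrite /sk mth sin2pi.
have sk2m1 : sk m.*2.+1 = sk 1.
  rewrite /sk -natr1 mulrDl mth mul1r addrC.
  by rewrite sinD cos2pi sin2pi mulr0 mulr1 addr0.
rewrite {1}vE iter_f // sk2m sk2m1 [RHS]vE.
by congr (_ + _ *: _ + _ *: _); ring.
Qed.

End Dihedral.

Section GeometricRepresentation.
Local Open Scope ring_scope.
Variables (R : realType) (W : groupType) (S : set W).
Implicit Types (s t : S) (v : geomV R S).

Lemma bform_sroot s v (d : {fset S}) : (msupp v `<=` d)%fset ->
  bform (sroot R s) v = \sum_(t <- d) mcoeff t v * bform_coef R s t.
Proof.
move=> vd; have s1 : msupp (sroot R s) = [fset s]%fset by rewrite msuppU oner_eq0.
rewrite /bform s1 big_seq_fset1 /sroot mcoeffUU.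
rewrite (eq_bigr (fun t => mcoeff t v * bform_coef R s t)); last first.
  by move=> t _; rewrite mul1r.
by apply: big_fset_incl => // t _ tv; rewrite mcoeff_outdom ?mul0r.
Qed.

Lemma bform_scalar s : scalar (bform (sroot R s)).
Proof.
move=> k u v; pose d := (msupp (k *: u + v) `|` msupp u `|` msupp v)%fset.
rewrite !(@bform_sroot _ _ d) /d; last 3 first.
- exact: fsubsetUr.
- by rewrite -fsetUA fsubsetU // fsubsetUl orbT.
- by rewrite -fsetUA fsubsetUl.
rewrite mulr_sumr -big_split /=; apply: eq_bigr => t _.
by rewrite mcoeffD mcoeffZ; ring.
Qed.

Lemma bform_roots s t : bform (sroot R s) (sroot R t) = bform_coef R s t.
Proof.
rewrite (@bform_sroot _ _ [fset t]%fset) ?msuppU ?oner_eq0 //.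
by rewrite big_seq_fset1 /sroot mcoeffUU mul1r.
Qed.

Lemma nat_min_eq (P : set nat) n :
  P n -> (forall k, P k -> (n <= k)%N) -> nat_min P = n.
Proof.
move=> Pn nP; rewrite /nat_min; apply: xget_unique => [|k [Pk kP]] //.
by apply/eqP; rewrite eqn_leq nP // kP.
Qed.

Lemma gorder1 : gorder (1 : W)%g = 1%N.
Proof. by apply: nat_min_eq => [|k []//]; split => //; rewrite expg1. Qed.

Lemma gorder_neq1 (w : W) : w <> 1%g -> gorder w <> 1%N.
Proof.
rewrite /gorder /nat_min; case: xgetP => [n ->|//] [[_ wn] _] + n1.
by move: wn; rewrite n1 expg1.
Qed.

Hypothesis WS : coxeter_system S.

Let S_inv s : (val s * val s = 1)%g.
Proof. by case: WS => H _ _; case: (H _ (set_mem (valP s))). Qed.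

Let bform_diag s : bform (sroot R s) (sroot R s) = 1.
Proof. by rewrite bform_roots /bform_coef S_inv gorder1 /= divr1 cospi opprK. Qed.

Lemma srefl_invol s : involutive (@srefl R W S s).
Proof.
move=> v; rewrite /srefl -!(@scaleNr _ (geomV R S)).
have -> (k : R) : bform (sroot R s) (v + k *: sroot R s) =
    bform (sroot R s) v + k.
  by rewrite addrC bform_scalar bform_diag mulr1 addrC.
by rewrite -addrA -scalerDl [X in X *: _](_ : _ = 0) ?scale0r ?addr0 //; ring.
Qed.

Lemma srefl_braid s t : (0 < gorder (val s * val t)%g)%N ->
  iter (gorder (val s * val t)%g) (@srefl R W S s \o @srefl R W S t) =1 id.
Proof.
have [->|st] := eqVneq s t.
  by rewrite S_inv gorder1 => _ v /=; rewrite srefl_invol.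
have st1 : (val s * val t <> 1)%g.
  move=> /(congr1 (fun x => x * val t)%g).
  by rewrite -mulgA S_inv mulg1 mul1g => /val_inj E; rewrite E eqxx in st.
have ts1 : (val t * val s)%g = (val s * val t)^-1%g.
  have inv (r : S) : ((val r)^-1 = val r)%g.
    by apply: (@mulgI W (val r)); rewrite mulgV S_inv.
  by rewrite invgM !inv.
set m := gorder _ => m_gt0 v.
have m_gt1 : (1 < m)%N.
  by rewrite ltn_neqAle m_gt0 eq_sym andbT; apply/eqP/gorder_neq1.
have mE : gorder (val t * val s)%g = m.
  rewrite ts1 /m /gorder; congr nat_min; apply/seteqP; split=> n /= [n0 wn];
    split=> //; apply: invg_inj; by rewrite invg1 -expVgn ?invgK.
have Bst : bform (sroot R s) (sroot R t) = - cos (pi / m%:R).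
  by rewrite bform_roots /bform_coef -/m; case: eqP m_gt1 => // ->.
have Bts : bform (sroot R t) (sroot R s) = - cos (pi / m%:R).
  by rewrite bform_roots /bform_coef mE; case: eqP m_gt1 => // ->.
exact: (iter_dihedral (bform_scalar s) (bform_scalar t) m_gt1).
Qed.

Lemma geometric_rep_exists : exists rho, @geometric_rep R W S rho.
Proof.
case: (WS) => _ _ /(_ (bijections (geomV R S))) univ.
pose f w : bijections (geomV R S) :=
  if pselect (S w) is left Sw then
    let s : S := exist _ w (mem_set Sw) in
    Bijection (srefl_invol s) (srefl_invol s)
  else 1%g.
have fE s : bij_fun (f (val s)) = @srefl R W S s.
  rewrite /f; case: pselect => [Sw|]; last by case; apply: set_mem; apply: valP.
  by congr srefl; apply: val_inj.
have [s t Ss St m_gt0|h [hM hf]] := univ f.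
  pose s' : S := exist _ s (mem_set Ss); pose t' : S := exist _ t (mem_set St).
  apply: bijections_ext; rewrite bij_funX /= (fE s') (fE t').
  exact: (@srefl_braid s' t').
exists (fun w => bij_fun (h w)); split=> [|x y|s].
- suff -> : h 1%g = 1%g by [].
  by apply: (mulgI (h 1%g)); rewrite -hM !mulg1.
- by rewrite hM.
- by rewrite hf ?fE //; apply: set_mem; apply: valP.
Qed.

Lemma geometric_rep_uniq rho rho' :
  @geometric_rep R W S rho -> @geometric_rep R W S rho' -> rho = rho'.
Proof.
move=> [r1 rM rS] [r1' rM' rS']; apply/funext => w.
case: (WS) => _ genS _; have : gen S w by rewrite genS.
have rV r : @geometric_rep R W S r -> forall x, r x^-1%g \o r x = id.
  by case=> q1 qM _ x; rewrite -qM mulVg.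
apply: (_ : gen S `<=` [set x | rho x = rho' x]).
apply: smallest_sub => [|s Ss] /=; last first.
  by rewrite (rS (exist _ s (mem_set Ss))) (rS' (exist _ s (mem_set Ss))).
split=> [|x y xE yE|x xE] /=; first by rewrite r1 r1'.
  by rewrite rM rM' xE yE.
have -> : rho x^-1%g = rho x^-1%g \o (rho' x \o rho' x^-1%g).
  by rewrite -rM' mulgV r1'.
by rewrite -xE; apply/funext => v /=; rewrite -[LHS]/((_ \o rho x) _) -rM mulVg r1.
Qed.

Lemma geom_actP : geometric_rep (@geom_act R W S).
Proof.
rewrite /geom_act; case: xgetP => [//|no].
by case: geometric_rep_exists => rho /no.
Qed.

End GeometricRepresentation.

Arguments Cham R {W} S I.
Arguments coset_face R {W} S J p.

(* Main.v *)
(* For theta in the closed chamber, w theta lies in the closed chamber only if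
   w theta = theta and w belongs to the parabolic subgroup of the walls
   containing theta; hence x C_J determines J and x W_J, so also the coset when
   I = x J x^-1.  Conversely, let w C_J lie on the walls of I, with |J| = |I|
   and w minimal in W_I w W_J.  Then w sends the simple roots of J to
   nonnegative vectors, and w^-1 sends those of I to nonnegative vectors
   supported on J: a negative image would make a simple root nonpositive.  As
   simple roots span extremal rays of the nonnegative cone, every simple root
   of I is proportional to w alpha_t for some t in J, so I is contained in
   w J w^-1, with equality by cardinality.  Everything rests on the fact that
   l(ws) > l(w) forces w alpha_s to be nonnegative. *)

Require Import Defs.
From Stdlib Require Import Relation_Operators.
From mathcomp Require Import all_boot all_order all_algebra finmap.
From mathcomp Require Import ring.
From mathcomp Require Import all_classical reals topology normedtype trigo.
From mathcomp Require Import function_spaces.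
From mathcomp Require monalg.
Import -(notations) monalg.

Set Implicit Arguments.
Unset Strict Implicit.
Unset Printing Implicit Defensive.

Import Order.TTheory GRing.Theory Num.Theory.
Import numFieldNormedType.Exports.

Local Open Scope classical_set_scope.

Lemma nat_minP (P : set nat) n : P n ->
  P (nat_min P) /\ (nat_min P <= n)%N.
Proof.
move=> Pn; have ex : exists k, `[< P k >] by exists n; apply/asboolP.
have [m /asboolP Pm mP] := ex_minnP ex.
have mP' k : P k -> (m <= k)%N by move=> Pk; apply: mP; apply/asboolP.
by rewrite (nat_min_eq Pm mP'); split=> //; apply: mP'.
Qed.

(** * Subgroups and the length function *)

Section Subgroups.
Local Open Scope group_scope.
Variable W : groupType.
Implicit Types (A B H : set W) (x y : W).

Lemma subgroup_gen A : subgroup (gen A).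
Proof.
split=> [H [[]]//|x y xA yA H HA|x xA H HA].
- by case: (HA) => -[_ HM _] _; apply: HM; [apply: xA|apply: yA].
- by case: (HA) => -[_ _ HV] _; apply: HV; apply: xA.
Qed.

Lemma sub_gen A : A `<=` gen A. Proof. exact: sub_smallest. Qed.

Lemma gen_sub A H : subgroup H -> A `<=` H -> gen A `<=` H.
Proof. exact: smallest_sub. Qed.

Lemma gen1 A : gen A 1. Proof. by case: (subgroup_gen A). Qed.

Lemma genM A x y : gen A x -> gen A y -> gen A (x * y).
Proof. by case: (subgroup_gen A) => _ + _; apply. Qed.

Lemma genV A x : gen A x -> gen A x^-1.
Proof. by case: (subgroup_gen A) => _ _; apply. Qed.

Lemma gen_conj A B w : (forall x, A x -> gen B (w * x * w^-1)) ->
  forall x, gen A x -> gen B (w * x * w^-1).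
Proof.
move=> AB; apply: gen_sub => //; split=> [|x y xB yB|x xB].
- by rewrite mulg1 mulgV; apply: gen1.
- suff -> : w * (x * y) * w^-1 = (w * x * w^-1) * (w * y * w^-1) by apply: genM.
  by rewrite !mulgA mulgVK.
- suff -> : w * x^-1 * w^-1 = (w * x * w^-1)^-1 by apply: genV.
  by rewrite !invgM invgK mulgA.
Qed.

Lemma double_cosetE I J p x : double_cosets I J p -> p x ->
  p = [set a * x * b | a in gen I & b in gen J].
Proof.
move=> [w ->] [a Ia [b Jb <-]]; apply/seteqP; split=> _ [c Ic [d Jd <-]].
- exists (c * a^-1); first by apply: genM => //; apply: genV.
  exists (b^-1 * d); first by apply: genM => //; apply: genV.
  by rewrite !mulgA mulgVK mulgK.
- exists (c * a); first exact: genM.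
  by exists (b * d); [exact: genM|rewrite !mulgA].
Qed.

End Subgroups.

Section Length.
Local Open Scope group_scope.
Variables (W : groupType) (S : set W).
Hypothesis WS : coxeter_system S.
Implicit Types (s t w x y : W).

Lemma cox_inv s : S s -> s^-1 = s.
Proof.
move=> Ss; case: WS => H _ _; case: (H _ Ss) => _ ss.
by apply: (@mulgI W s); rewrite mulgV ss.
Qed.

Lemma cox_mulK s x : S s -> x * s * s = x.
Proof. by move=> Ss; rewrite -{2}(cox_inv Ss) mulgK. Qed.

Lemma gen_top w : gen S w.
Proof. by case: WS => _ -> _. Qed.

Lemma prod_rev (u : seq W) : [set` u] `<=` S ->
  \prod_(s <- rev u) s = (\prod_(s <- u) s)^-1.
Proof.
elim: u => [|s u IHu] uS; first by rewrite !big_nil invg1.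
rewrite big_cons rev_cons -cats1 big_cat /= big_seq1 invgM IHu.
  by rewrite (@cox_inv s) //; apply: uS; rewrite /= mem_head.
by move=> r /= ru; apply: uS; rewrite /= inE ru orbT.
Qed.

(** Words are closed under concatenation and reversal, so they exhaust [W]; hence [length] never
    falls back on its default value. *)
Lemma word_exists w : exists2 u : seq W, [set` u] `<=` S & w = \prod_(s <- u) s.
Proof.
have : gen S w by exact: gen_top.
pose H := [set w | exists2 u : seq W, [set` u] `<=` S & w = \prod_(s <- u) s].
apply: (_ : gen S `<=` H); apply: gen_sub; last first.
  move=> s Ss; exists [:: s]; last by rewrite big_seq1.
  by move=> r; rewrite /= inE => /eqP->.
split=> [|_ _ [u uS ->] [v vS ->]|_ [u uS ->]].
- by exists [::]; [move=> r; rewrite /= in_nil|rewrite big_nil].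
- exists (u ++ v); last by rewrite big_cat.
  by move=> r; rewrite /= mem_cat => /orP[/uS|/vS].
- exists (rev u); last by rewrite prod_rev.
  by move=> r; rewrite /= mem_rev => /uS.
Qed.

Lemma length_spec w (u : seq W) : [set` u] `<=` S -> w = \prod_(s <- u) s ->
  (exists v : seq W,
    [/\ size v = length S w, [set` v] `<=` S & w = \prod_(s <- v) s]) /\
  (length S w <= size u)%N.
Proof. by move=> uS wu; apply: nat_minP; exists u. Qed.

Lemma lengthP w : exists u : seq W,
  [/\ size u = length S w, [set` u] `<=` S & w = \prod_(s <- u) s].
Proof. by have [u uS wu] := word_exists w; case: (length_spec uS wu). Qed.

Lemma length_le (u : seq W) : [set` u] `<=` S ->
  (length S (\prod_(s <- u) s) <= size u)%N.
Proof. by move=> uS; case: (length_spec uS erefl). Qed.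

Lemma length_mul s w : S s -> (length S (w * s) <= (length S w).+1)%N.
Proof.
move=> Ss; have [u [<- uS ->]] := lengthP w.
have := @length_le (rcons u s); rewrite -cats1 big_cat /= big_seq1 size_cat addn1.
by apply=> r; rewrite /= mem_cat inE => /orP[/uS//|/eqP->].
Qed.

Lemma length_inv w : length S w^-1 = length S w.
Proof.
suff le x : (length S x^-1 <= length S x)%N.
  by apply/eqP; rewrite eqn_leq le -{1}[w]invgK le.
have [u [<- uS ->]] := lengthP x; rewrite -(size_rev u).
by rewrite -prod_rev //; apply: length_le => r; rewrite /= mem_rev => /uS.
Qed.

Lemma descent_exists w : w <> 1 ->
  exists2 s, S s & (length S (w * s) < length S w)%N.
Proof.
have [u [<-]] := lengthP w; case/lastP: u => [|u s] uS ->.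
  by rewrite big_nil.
have Ss : S s by apply: uS; rewrite /= mem_rcons mem_head.
exists s => //; rewrite -cats1 big_cat /= big_seq1 cox_mulK // size_cat addn1.
by apply: length_le => r /= ru; apply: uS; rewrite /= mem_rcons inE ru orbT.
Qed.

(* The universal property yields the sign character, whose value at w depends
   only on the parity of the length of w. *)
Lemma length_parity s w : S s -> length S (w * s) <> length S w.
Proof.
(* Negation of booleans plays the part of -1 in the group of signs. *)
pose g : bijections bool := Bijection negbK negbK.
have gg : g * g = 1 by apply: bijections_ext => b /=; rewrite negbK.
case: (WS) => _ _ /(_ _ (fun=> g))[s' t' _ _ _|h [hM hS]].
  by rewrite gg expg1n.
have h1 : h 1 = 1 by apply: (mulgI (h 1)); rewrite -hM !mulg1.
have hg x : h x = g ^+ length S x.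
  have [u [<- + ->]] := lengthP x; elim: u => [|r u IHu] uS.
    by rewrite big_nil h1.
  rewrite big_cons hM hS ?IHu ?expgS //; last by apply: uS; rewrite /= mem_head.
  by move=> q /= qu; apply: uS; rewrite /= inE qu orbT.
move=> Ss e; have := hg (w * s); rewrite e -hg hM (hS s Ss) -[X in _ = X]mulg1.
by move=> /mulgI/(congr1 (fun f => bij_fun f true)).
Qed.

Lemma length_ltn s w : S s ->
  (length S w < length S (w * s))%N = ~~ (length S (w * s) < length S w)%N.
Proof.
move=> Ss; have := @length_parity s w Ss.
by case: ltngtP => // e ne; case: ne.
Qed.

End Length.

(** * Positivity of roots *)

Section Alternating.
Local Open Scope group_scope.
Variable W : groupType.
Implicit Types s t x : W.

Fixpoint altw s t k : W := if k is k'.+1 then s * altw t s k' else 1.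

Lemma altwS s t k : altw s t k.+1 = altw s t k * (if odd k then t else s).
Proof.
elim: k s t => [|k IHk] s t; first by rewrite /= mulg1 mul1g.
by rewrite [LHS]/= -/(altw t s k.+1) IHk /= mulgA if_neg.
Qed.

(** When [k] is the order of [s * t] the power is trivial, and this becomes the braid relation. *)
Lemma altw_swap s t k : s * s = 1 -> t * t = 1 ->
  (s * t) ^+ k * altw t s k = altw s t k.
Proof.
move=> ss tt; elim: k s t ss tt => [|k IHk] s t ss tt; first by rewrite mulg1.
have st_s n : (s * t) ^+ n * s = s * (t * s) ^+ n.
  elim: n => [|n IHn]; first by rewrite mulg1 mul1g.
  by rewrite !expgS -mulgA IHn !mulgA.
rewrite /= -(IHk t s) // !mulgA -st_s expgSr; congr (_ * _).
by rewrite -!mulgA tt mulg1.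
Qed.

Lemma gorderV x : gorder x^-1 = gorder x.
Proof.
rewrite /gorder; congr nat_min; apply/seteqP.
split=> n /= [n0 xn]; split=> //; apply: invg_inj; rewrite invg1.
  by rewrite -expVgn.
by rewrite -expVgn invgK.
Qed.

(** When [x] has infinite order, [gorder x] is 0 and the power is empty. *)
Lemma expg_gorder x : x ^+ gorder x = 1.
Proof.
have [->|/eqP] := eqVneq (gorder x) 0%N; first by rewrite expg0.
by rewrite /gorder /nat_min; case: xgetP => [n -> [[]]|//].
Qed.

End Alternating.

(** * Chebyshev polynomials and their positivity *)

Section Chebyshev.
Local Open Scope ring_scope.
Variable R : realType.

(* [cheb c k] is the Chebyshev polynomial of the second kind of index k - 1. *)
Fixpoint cheb (c : R) k : R :=
  if k is k1.+1 then
    if k1 is k2.+1 then 2 * c * cheb c k1 - cheb c k2 else 1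
  else 0.

Lemma chebSS c k : cheb c k.+2 = 2 * c * cheb c k.+1 - cheb c k.
Proof. by []. Qed.

Lemma cheb_sin th k : cheb (cos th) k * sin th = sin (k%:R * th).
Proof.
suff : cheb (cos th) k * sin th = sin (k%:R * th) /\
       cheb (cos th) k.+1 * sin th = sin (k.+1%:R * th) by case.
elim: k => [|k [IH0 IH1]]; first by rewrite /= !mul0r sin0 !mul1r.
split=> //; rewrite chebSS mulrBl IH0 -(mulrA (2 * cos th)) IH1.
have -> : sin (k.+2%:R * th) = sin (k.+1%:R * th + th).
  by rewrite -(natr1 k.+1); congr sin; ring.
have -> : sin (k%:R * th) = sin (k.+1%:R * th - th).
  by rewrite -natr1; congr sin; ring.
by rewrite sinB sinD; ring.
Qed.

(** The value [c = 1] is the case of infinite order, where the bilinear form is -1. *)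
Lemma cheb_one k : cheb 1 k = k%:R.
Proof.
suff : cheb 1 k = k%:R /\ cheb 1 k.+1 = k.+1%:R by case.
elim: k => [|k [IH0 IH1]]; first by [].
by split=> //; rewrite chebSS IH0 IH1 -!natr1; ring.
Qed.

(** For [k <= m] the angle [k * pi / m] stays between 0 and [pi], where the sine is nonnegative. *)
Lemma cheb_cos_ge0 m k : (1 < m)%N -> (k <= m)%N -> 0 <= cheb (cos (pi / m%:R)) k.
Proof.
move=> m1 km; have m_gt0 : 0 < m%:R :> R by rewrite ltr0n ltnW.
have th0 : 0 < pi / m%:R :> R by rewrite divr_gt0 ?pi_gt0.
have th1 : pi / m%:R < pi :> R.
  by rewrite ltr_pdivrMr // ltr_pMr ?pi_gt0 // ltr1n.
have s0 : 0 < sin (pi / m%:R) :> R by apply: sin_gt0_pi; rewrite th0 th1.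
rewrite -(pmulr_lge0 _ s0) cheb_sin sin_ge0_pi // mulr_ge0 /=; last 2 first.
- exact: ler0n.
- exact: ltW.
by rewrite mulrCA ger_pMr ?pi_gt0 // ler_pdivrMr // mul1r ler_nat.
Qed.

End Chebyshev.

Section ModuleIdentities.
Local Open Scope ring_scope.
Variables (R : realType) (V : lmodType R).

Lemma scaler_refl_lin (k a b : R) (u v z : V) :
  k *: u + v - (2 * (k * a + b)) *: z =
  k *: (u - (2 * a) *: z) + (v - (2 * b) *: z).
Proof.
by rewrite scalerBr scalerA addrACA -opprD -scalerDl; congr (_ - _ *: _); ring.
Qed.

Lemma scaler_comb (a b c d e : R) (u v : V) :
  - (a *: u + b *: v) + e *: (d *: v + c *: u) =
  (e * c - a) *: u + (e * d - b) *: v.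
Proof.
rewrite (addrC (d *: v)) scalerDr !scalerA opprD addrC -!(@scaleNr R V).
by rewrite addrACA -!scalerDl.
Qed.

Lemma scalerNN1 (c : R) (u : V) : - (c *: - u) = c *: u.
Proof. by rewrite scalerN opprK. Qed.

End ModuleIdentities.

(** * The geometric representation and its dihedral roots *)

Section RootSystem.
Local Open Scope ring_scope.
Variables (R : realType) (W : groupType) (S : set W).
Hypothesis WS : coxeter_system S.
Implicit Types (s t r : S) (u v : geomV R S) (w x y : W).

Local Notation rho := (@geom_act R W S).
Local Notation alpha := (@sroot R W S).

Lemma set_val_in s : S (val s). Proof. exact: set_mem (valP s). Qed.

Lemma geom_act1 v : rho 1%g v = v.
Proof. by have [-> _ _] := geom_actP R WS. Qed.

Lemma geom_actM x y v : rho (x * y)%g v = rho x (rho y v).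
Proof. by have [_ -> _] := geom_actP R WS. Qed.

Lemma geom_actS s v : rho (val s) v = srefl s v.
Proof. by have [_ _ ->] := geom_actP R WS. Qed.

Lemma geom_actK w : cancel (rho w) (rho w^-1%g).
Proof. by move=> v; rewrite -geom_actM mulVg geom_act1. Qed.

Lemma geom_actVK w : cancel (rho w^-1%g) (rho w).
Proof. by move=> v; rewrite -geom_actM mulgV geom_act1. Qed.

Lemma geom_act_lin w k u v : rho w (k *: u + v) = k *: rho w u + rho w v.
Proof.
have [q qS ->] := word_exists WS w; elim: q qS => [|a q IHq] qS.
  by rewrite big_nil !geom_act1.
have Sa : S a by apply: qS; rewrite /= mem_head.
rewrite big_cons !geom_actM IHq; last first.
  by move=> b /= bq; apply: qS; rewrite /= inE bq orbT.
rewrite -[a]/(val (exist _ a (mem_set Sa) : S)) !geom_actS /srefl bform_scalar.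
exact: scaler_refl_lin.
Qed.

Lemma geom_actZ w k v : rho w (k *: v) = k *: rho w v.
Proof.
have w0 : rho w 0 = 0.
  by apply: (@addrI _ (rho w 0)); rewrite -{1}[rho w 0]scale1r -geom_act_lin
     scale1r !addr0.
by rewrite -[k *: v]addr0 geom_act_lin w0 addr0.
Qed.

Lemma geom_actD w u v : rho w (u + v) = rho w u + rho w v.
Proof. by rewrite -{1}[u]scale1r geom_act_lin scale1r. Qed.

Lemma geom_actN w v : rho w (- v) = - rho w v.
Proof. by rewrite -scaleN1r geom_actZ scaleN1r. Qed.

Lemma bform_diag s : bform (alpha s) (alpha s) = 1.
Proof.
by rewrite bform_roots /bform_coef -[X in gorder (X * _)%g](cox_inv WS (set_val_in s))
  mulVg gorder1 /= divr1 cospi opprK.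
Qed.

Lemma bform_coef_sym s t : bform_coef R s t = bform_coef R t s.
Proof.
rewrite /bform_coef -(gorderV (val t * val s)) invgM.
by rewrite !(cox_inv WS (set_val_in _)).
Qed.

Lemma srefl_root s t :
  rho (val s) (alpha t) = alpha t + (2 * - bform_coef R s t) *: alpha s.
Proof. by rewrite geom_actS /srefl bform_roots mulrN scaleNr. Qed.

Lemma srefl_self s : rho (val s) (alpha s) = - alpha s.
Proof.
rewrite geom_actS /srefl bform_diag mulr1 -[X in X - _]scale1r -scalerBl.
have -> : 1 - 2 = -1 :> R by ring.
exact: scaleN1r.
Qed.

Lemma geom_actVS s x v : rho (val s * x)^-1%g v = rho x^-1%g (rho (val s) v).
Proof. by rewrite invgM geom_actM (cox_inv WS (set_val_in s)). Qed.

Lemma altw_root s t k (c := - bform_coef R s t) :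
  rho (altw (val t) (val s) k)^-1%g (alpha s) =
  if odd k then cheb c k *: alpha s + cheb c k.+1 *: alpha t
  else cheb c k.+1 *: alpha s + cheb c k *: alpha t.
Proof.
have ct : - bform_coef R t s = c by rewrite bform_coef_sym.
(* Each new letter exchanges the roles of [s] and [t], and the recurrence has order two, so the
   induction carries both roots and two consecutive indices. *)
suff : [/\
    rho (altw (val t) (val s) k)^-1%g (alpha s) =
      (if odd k then cheb c k *: alpha s + cheb c k.+1 *: alpha t
       else cheb c k.+1 *: alpha s + cheb c k *: alpha t),
    rho (altw (val t) (val s) k.+1)^-1%g (alpha s) =
      (if odd k then cheb c k.+2 *: alpha s + cheb c k.+1 *: alpha t
       else cheb c k.+1 *: alpha s + cheb c k.+2 *: alpha t),
    rho (altw (val s) (val t) k)^-1%g (alpha t) =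
      (if odd k then cheb c k *: alpha t + cheb c k.+1 *: alpha s
       else cheb c k.+1 *: alpha t + cheb c k *: alpha s) &
    rho (altw (val s) (val t) k.+1)^-1%g (alpha t) =
      (if odd k then cheb c k.+2 *: alpha t + cheb c k.+1 *: alpha s
       else cheb c k.+1 *: alpha t + cheb c k.+2 *: alpha s)] by case.
elim: k => [|k [IHs0 IHs1 IHt0 IHt1]].
  split; rewrite /= ?invg1 ?mulg1 ?(cox_inv WS (set_val_in _)) ?geom_act1
    ?srefl_root ?ct ?mulr1 ?subr0 ?scale1r ?scale0r ?addr0 //.
split.
- by rewrite IHs1 /=; case: ifP.
(* The letter [t] sends [alpha s] to [alpha s] plus [2 * c] times [alpha t], and the next letter [s]
   negates [alpha s]: together they give the recurrence of [cheb]. *)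
- rewrite [altw _ _ _]/= geom_actVS srefl_root ct geom_actD geom_actZ.
  rewrite -[(_ * altw _ _ _)%g]/(altw (val s) (val t) k.+1) IHt1.
  rewrite [altw _ _ _]/= geom_actVS srefl_self geom_actN IHs0.
  by rewrite oddS; case: (odd k); rewrite scaler_comb.
- by rewrite IHt1 /=; case: ifP.
- rewrite [altw _ _ _]/= geom_actVS srefl_root geom_actD geom_actZ.
  rewrite -[(_ * altw _ _ _)%g]/(altw (val t) (val s) k.+1) IHs1 -/c.
  rewrite [altw _ _ _]/= geom_actVS srefl_self geom_actN IHt0.
  by rewrite oddS; case: (odd k); rewrite scaler_comb.
Qed.

End RootSystem.

Section Positivity.
Local Open Scope ring_scope.
Variables (R : realType) (W : groupType) (S : set W).
Hypothesis WS : coxeter_system S.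
Implicit Types (s t r : S) (u v : geomV R S) (w x y : W).

Local Notation rho := (@geom_act R W S).
Local Notation alpha := (@sroot R W S).
Local Notation len := (length S).

Definition nneg v := forall s, 0 <= mcoeff s v.

Lemma mcoeff_root s t : mcoeff s (alpha t) = (t == s)%:R.
Proof. by rewrite /sroot mcoeffU; case: eqP. Qed.

Lemma nneg_root s : nneg (alpha s).
Proof. by move=> t; rewrite mcoeff_root ler0n. Qed.

Lemma gcoeffZ s (a : R) v : mcoeff s (a *: v) = a * mcoeff s v.
Proof. exact: mcoeffZ. Qed.

Lemma gcoeff_comb s (a b : R) u v :
  mcoeff s (a *: u + b *: v) = a * mcoeff s u + b * mcoeff s v.
Proof. by rewrite (mcoeffD s) (mcoeffZ a) (mcoeffZ b). Qed.

Lemma geom_act_comb w (a b : R) u v :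
  rho w (a *: u + b *: v) = a *: rho w u + b *: rho w v.
Proof. by rewrite (geom_act_lin WS) (geom_actZ WS w b v). Qed.

Lemma nneg_comb (a b : R) u v : 0 <= a -> 0 <= b -> nneg u -> nneg v ->
  nneg (a *: u + b *: v).
Proof.
move=> a0 b0 u0 v0 s; rewrite gcoeff_comb.
by apply: addr_ge0; apply: mulr_ge0.
Qed.

(** The value 0 of [gorder] encodes infinite order, where every index is allowed. Otherwise the
    order is at least 2, as order 1 would force [s = t]. *)
Lemma cheb_bform_ge0 s t k : s != t ->
  (gorder (val s * val t)%g == 0%N) || (k <= gorder (val s * val t)%g)%N ->
  0 <= cheb (- bform_coef R s t) k.
Proof.
move=> st; rewrite /bform_coef.
have [_ _|m0 /= km] := eqVneq; first by rewrite opprK cheb_one ler0n.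
rewrite opprK; apply: cheb_cos_ge0 => //.
have : gorder (val s * val t)%g <> 1%N.
  apply: gorder_neq1 => e; move/eqP: st; apply; apply: val_inj.
  apply: (@mulIg _ (val t)); rewrite e -{1}(cox_inv WS (set_val_in t)).
  by rewrite mulVg.
by case: (gorder _) m0 km => [|[|]].
Qed.

Lemma length_le_mul s x : (len x <= (len (x * val s)%g).+1)%N.
Proof.
have := length_mul WS (x * val s)%g (set_val_in s).
by rewrite (cox_mulK WS) //; exact: set_val_in.
Qed.

Lemma length_le_altw s t x k j :
  (len (x * altw (val s) (val t) k)%g <=
   len (x * altw (val s) (val t) (k + j))%g + j)%N.
Proof.
elim: j => [|j IHj]; first by rewrite !addn0.
apply: (leq_trans IHj); rewrite !addnS -addSn leq_add2r altwS mulgA.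
by case: ifP => _; exact: length_le_mul.
Qed.

(* Peel off letters of the dihedral subgroup <s, t> from the right of w as long
   as the length drops: the remaining factor v increases under both s and t, so
   by induction it keeps alpha_s and alpha_t nonnegative, while w alpha_s is a
   combination of v alpha_s and v alpha_t with coefficients sin (k pi / m) /
   sin (pi / m), where 0 <= k <= m (or k when m is infinite). *)
Theorem root_nneg w s : (len w < len (w * val s)%g)%N -> nneg (rho w (alpha s)).
Proof.
have [n] := ubnP (len w); elim: n w s => // n IHn w s; rewrite ltnS => wn ws.
have [-> | /eqP w1] := eqVneq w 1%g; first by rewrite geom_act1 //; exact: nneg_root.
have [t0 St0 wt] := descent_exists WS w1.
pose t : S := exist _ t0 (mem_set St0).
have {wt} wt : (len (w * val t)%g < len w)%N by exact: wt.
have st : s != t.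
  by apply/eqP => e; move: wt; rewrite -e ltnNge (ltnW ws).
have inv r := cox_inv WS (set_val_in r).
have sq r : (val r * val r = 1)%g by rewrite -{1}(inv r) mulVg.
(* [a k] is [w] multiplied on the right by [k] alternating letters, beginning with the descent
   [t]. *)
pose a k := (w * altw (val t) (val s) k)%g.
have a0 : a 0%N = w by rewrite /a /= mulg1.
have aS k : a k.+1 = (a k * val (if odd k then s else t))%g.
  by rewrite /a altwS mulgA; case: (odd k).
have a_ge k : (len w <= len (a k) + k)%N.
  by have := length_le_altw t s w 0 k; rewrite mulg1 add0n.
(* Each letter changes the length by at most one, so [Q k] says that all of the first [k] letters
   lower it. *)
pose Q k := (len (a k) + k == len w)%N.
have Q1 : Q 1%N.
  rewrite /Q eqn_leq a_ge andbT addn1 aS a0 /=; exact: wt.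
have Qle k : Q k -> (k <= len w)%N by move=> /eqP <-; apply: leq_addl.
have [k Qk kmax] := ex_maxnP (ex_intro Q 1%N Q1) Qle.
have k1 : (1 <= k)%N by exact: kmax.
(* From here on the maximal number of letters is [k.+1]. *)
case: k Qk k1 kmax => // k Qk _ kmax.
have vn : (len (a k.+1) < n)%N.
  apply: leq_trans wn; rewrite -(eqP Qk) addnS ltnS; exact: leq_addr.
(* Undoing the last letter raises the length; by maximality the other letter raises it too. *)
have up_last : (len (a k.+1) < len (a k.+1 * val (if odd k then s else t))%g)%N.
  rewrite {2}aS -mulgA sq mulg1 -(leq_add2r k) addSnnS (eqP Qk); exact: a_ge.
have up_next : (len (a k.+1) < len (a k.+1 * val (if odd k then t else s))%g)%N.
  rewrite (length_ltn WS _ (set_val_in _)); apply/negP => dn.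
  suff : Q k.+2 by move=> /kmax; rewrite ltnn.
  rewrite /Q eqn_leq a_ge andbT aS addnS -addSn /= if_neg -(eqP Qk) leq_add2r.
  exact: dn.
have vs : nneg (rho (a k.+1) (alpha s)).
  by apply: IHn => //; case: (odd k) up_last up_next.
have vt : nneg (rho (a k.+1) (alpha t)).
  by apply: IHn => //; case: (odd k) up_last up_next.
have wE : w = (a k.+1 * (altw (val t) (val s) k.+1)^-1)%g by rewrite /a mulgK.
(* The coefficients to be bounded have index up to [k.+2]. If the order [m] were at most [k.+1], the
   braid relation would write [a m] as [w * s] followed by [m - 1] letters; as [w * s] is longer
   than [w], the length of [a m] would exceed [len w - m], against the [m] drops. *)
have km : (gorder (val s * val t)%g == 0%N) || (k.+2 <= gorder (val s * val t)%g)%N.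
  have [//|m0 /=] := eqVneq; rewrite ltnNge; apply/negP => mk.
  set m := gorder _ in m0 mk.
  have am : (len (a m) + m <= len w)%N.
    rewrite -(eqP Qk) -{2}(subnK mk) addnA leq_add2r.
    by have := length_le_altw t s w m (k.+1 - m); rewrite subnKC.
  have swap : altw (val t) (val s) m = altw (val s) (val t) m.
    by rewrite -[RHS]altw_swap // expg_gorder mul1g.
  case: m m0 mk am swap => // m _ _ am swap.
  have := length_le_altw t s (w * val s)%g 0 m.
  rewrite mulg1 add0n -mulgA -[(val s * _)%g]/(altw (val s) (val t) m.+1) -swap.
  move=> wsm; move: am; rewrite addnS ltnNge => /negP; apply.
  exact: leq_trans (ltnW ws) wsm.
rewrite {1}wE geom_actM // altw_root //.
have c0 j : (j <= k.+2)%N -> 0 <= cheb (- bform_coef R s t) j.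
  move=> jk; apply: cheb_bform_ge0 => //.
  by case/orP: km => [->//|km]; rewrite (leq_trans jk km) orbT.
case: ifP => _; rewrite geom_act_comb.
  by apply: nneg_comb => //; apply: c0.
by apply: nneg_comb => //; apply: c0.
Qed.

End Positivity.

(** * Signs of roots, and linear functionals *)

Section Roots.
Local Open Scope ring_scope.
Variables (R : realType) (W : groupType) (S : set W).
Hypothesis WS : coxeter_system S.
Implicit Types (s t r : S) (u v : geomV R S) (w x y : W).

Local Notation rho := (@geom_act R W S).
Local Notation alpha := (@sroot R W S).
Local Notation len := (length S).

Lemma gcoeffN s v : mcoeff s (- v) = - mcoeff s v.
Proof. exact: mcoeffN. Qed.

Lemma geomV_ext u v : (forall s, mcoeff s u = mcoeff s v) -> u = v.
Proof. by move=> /malgP. Qed.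

Lemma nneg_anti v : nneg v -> nneg (- v) -> v = 0.
Proof.
move=> v0 Nv0; apply: geomV_ext => s; rewrite mcoeff0.
by apply/eqP; rewrite eq_le v0 -oppr_ge0 -gcoeffN Nv0.
Qed.

Lemma root_neq0 w s : rho w (alpha s) <> 0.
Proof.
move=> /(congr1 (rho w^-1%g)); rewrite (geom_actK WS).
have -> : rho w^-1%g 0 = 0.
  by rewrite -[in LHS](scale0r (0 : geomV R S)) (geom_actZ WS) scale0r.
move=> /(congr1 (mcoeff s)); rewrite mcoeff_root eqxx mcoeff0 => /eqP.
by rewrite oner_eq0.
Qed.

(** Since [s] negates its own root, this is [root_nneg] applied to [w * s]. *)
Lemma root_npos w s : (len (w * val s)%g < len w)%N -> nneg (- rho w (alpha s)).
Proof.
move=> ws; rewrite -(geom_actN WS) -(srefl_self R WS) -(geom_actM WS).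
by apply: (root_nneg R WS); rewrite (cox_mulK WS) //; exact: set_val_in.
Qed.

Lemma root_sign w s : nneg (rho w (alpha s)) \/ nneg (- rho w (alpha s)).
Proof.
have := length_ltn WS w (set_val_in s).
case: (ltnP (len w) (len (w * val s)%g)) => [/(root_nneg R WS)|_ /esym/negbFE/root_npos].
  by left.
by right.
Qed.

(** A descent [s] of [w] would make [w alpha_s] both nonnegative and nonpositive, hence zero. *)
Lemma nneg_roots_eq1 w : (forall s, nneg (rho w (alpha s))) -> w = 1%g.
Proof.
move=> w0; have [//|/eqP w1] := eqVneq w 1%g.
have [s Ss ws] := descent_exists WS w1.
case: (@root_neq0 w (exist _ s (mem_set Ss))).
by apply: nneg_anti => //; apply: root_npos.
Qed.

(** The scalar 1 is displayed so that the equation fits [gcoeff_comb] and the definition of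
    [scalar]. *)
Lemma srefl_comb s v : exists c, rho (val s) v = 1 *: v + c *: alpha s.
Proof.
exists (- (2 * bform (alpha s) v)).
by rewrite (geom_actS WS) /srefl -(@scaleNr R (geomV R S)) scale1r.
Qed.

(* If [w alpha_s] is proportional to [alpha_t], then [t (w s w^-1)] maps every
   simple root to a root with a positive coefficient, so it has no descent. *)
Lemma root_prop_conj w s t (c : R) : rho w (alpha s) = c *: alpha t ->
  (w * val s * w^-1)%g = val t.
Proof.
move=> ws; have c0 : c != 0.
  by apply/eqP => c0; case: (@root_neq0 w s); rewrite ws c0 scale0r.
suff e : (val t * (w * val s * w^-1))%g = 1%g.
  apply: (@mulgI _ (val t)); rewrite e -[X in (X * _)%g](cox_inv WS (set_val_in t)).
  by rewrite mulVg.
apply: nneg_roots_eq1 => r.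
have [->|rt] := eqVneq r t.
  suff -> : rho (val t * (w * val s * w^-1))%g (alpha t) = alpha t.
    exact: nneg_root.
  apply: (@scalerI R (geomV R S) c c0).
  rewrite -(geom_actZ WS) -ws 3!(geom_actM WS) (geom_actK WS) (srefl_self R WS).
  rewrite (geom_actN WS w) (geom_actN WS (val t)) ws (geom_actZ WS) (srefl_self R WS).
  exact: scalerNN1.
have [d dE] : exists d, rho (val t * (w * val s * w^-1))%g (alpha r) =
    1 *: alpha r + d *: alpha t.
  rewrite 3!(geom_actM WS); have [k ->] := srefl_comb s (rho w^-1%g (alpha r)).
  rewrite geom_act_comb // (geom_actVK WS) ws scalerA geom_act_comb //.
  rewrite (srefl_self R WS); have [k' ->] := srefl_comb t (alpha r).
  exists (k' - k * c); rewrite !scale1r -addrA; congr (_ + _).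
  by rewrite scalerN -(@scaleNr R (geomV R S)) -scalerDl.
case: (root_sign (val t * (w * val s * w^-1)) r) => // /(_ r).
rewrite gcoeffN dE gcoeff_comb // !mcoeff_root eqxx eq_sym (negbTE rt) mulr0 addr0.
by rewrite mulr1 oppr_ge0 ler10.
Qed.

Lemma geomV_sum v : v = \sum_(s <- msupp v) mcoeff s v *: alpha s.
Proof.
rewrite {1}[v]monalgE; apply: eq_bigr => s _; apply: geomV_ext => t.
by rewrite /sroot (mcoeffZ (mcoeff s v)) (mcoeffU s (mcoeff s v) t) (mcoeffU s 1 t) mulr_natr.
Qed.

Lemma scalar0 (theta : geomV R S -> R) : scalar theta -> theta 0 = 0.
Proof.
move=> th; have := th 1 0 0; rewrite scale1r addr0 mul1r => /eqP.
by rewrite -subr_eq0 opprD addNKr oppr_eq0 => /eqP.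
Qed.

Lemma scalar_sum (theta : geomV R S -> R) v : scalar theta ->
  theta v = \sum_(s <- msupp v) mcoeff s v * theta (alpha s).
Proof.
move=> th; have th0 := scalar0 th.
suff H (q : seq S) : theta (\sum_(s <- q) mcoeff s v *: alpha s) =
    \sum_(s <- q) mcoeff s v * theta (alpha s).
  by rewrite -H -geomV_sum.
elim: q => [|s q IHq]; first by rewrite !big_nil; exact: th0.
by rewrite !big_cons th IHq.
Qed.

Lemma scalar_ge0 (theta : geomV R S -> R) v : scalar theta ->
  (forall s, 0 <= theta (alpha s)) -> nneg v -> 0 <= theta v.
Proof.
move=> th th0 v0; rewrite scalar_sum //; apply: sumr_ge0 => s _.
exact: mulr_ge0.
Qed.

Lemma scalar_eq0 (theta : geomV R S -> R) v s : scalar theta ->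
  (forall t, 0 <= theta (alpha t)) -> nneg v -> theta v = 0 ->
  0 < theta (alpha s) -> mcoeff s v = 0.
Proof.
move=> th th0 v0; rewrite scalar_sum // => /eqP.
rewrite psumr_eq0 => [/allP vth0 ths|t _]; last exact: mulr_ge0.
have [sv|/mcoeff_outdom//] := boolP (s \in msupp v).
by have := vth0 s sv; rewrite /= mulf_eq0 (gt_eqF ths) orbF => /eqP.
Qed.

Lemma scalarN (theta : geomV R S -> R) v : scalar theta -> theta (- v) = - theta v.
Proof.
move=> th; have th0 := scalar0 th.
by have := th (-1) v 0; rewrite addr0 th0 addr0 scaleN1r mulN1r.
Qed.

(** The linear functional with prescribed values [c] on the basis of simple roots. *)
Definition lin_of (c : S -> R) (v : geomV R S) : R :=
  \sum_(s <- msupp v) mcoeff s v * c s.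

Lemma lin_ofE (c : S -> R) v (d : {fset S}) : (msupp v `<=` d)%fset ->
  lin_of c v = \sum_(s <- d) mcoeff s v * c s.
Proof.
move=> vd; apply: big_fset_incl => // t _ tv.
by rewrite mcoeff_outdom ?mul0r.
Qed.

Lemma lin_of_scalar (c : S -> R) : scalar (lin_of c).
Proof.
move=> k u v; pose d := (msupp (k *: u + v) `|` msupp u `|` msupp v)%fset.
rewrite !(@lin_ofE _ _ d) /d; last 3 first.
- exact: fsubsetUr.
- by rewrite -fsetUA fsubsetU // fsubsetUl orbT.
- by rewrite -fsetUA fsubsetUl.
rewrite mulr_sumr -big_split /=; apply: eq_bigr => t _.
by rewrite mcoeffD mcoeffZ; ring.
Qed.

Lemma lin_of_root (c : S -> R) s : lin_of c (alpha s) = c s.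
Proof.
rewrite (@lin_ofE _ _ [fset s]%fset) ?msuppU ?oner_eq0 //.
by rewrite big_seq_fset1 mcoeff_root eqxx mul1r.
Qed.

End Roots.

(** * The dual action and the fundamental domain *)

(** The pointwise topology is the supremum of the topologies pulled back along evaluations. *)
Lemma ptws_cvg (T U : Type) (V : topologicalType) (F : set_system U)
    (f : U -> {ptws T -> V}) (g : {ptws T -> V}) : Filter F ->
  (forall x, f^~ x @ F --> g x) -> f @ F --> g.
Proof.
move=> FF fg; apply/cvg_sup => x A [_ [[B oB <-] /= Bg]] /filterS; apply.
by apply: fg; apply: open_nbhs_nbhs.
Qed.

Section DualAction.
Local Open Scope ring_scope.
Variables (R : realType) (W : groupType) (S : set W).
Hypothesis WS : coxeter_system S.
Implicit Types (s t r : S) (u v : geomV R S) (w x y : W) (I J : set W).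
Implicit Types theta phi : {ptws geomV R S -> R}.

Local Notation rho := (@geom_act R W S).
Local Notation alpha := (@sroot R W S).
Local Notation len := (length S).

Lemma dual_act1 theta : dual_act 1%g theta = theta.
Proof. by apply/funext => v; rewrite /dual_act invg1 (geom_act1 WS). Qed.

Lemma dual_actM x y theta :
  dual_act (x * y)%g theta = dual_act x (dual_act y theta).
Proof. by apply/funext => v; rewrite /dual_act invgM (geom_actM WS). Qed.

Lemma dual_actK w : cancel (@dual_act R W S w) (dual_act w^-1%g).
Proof. by move=> theta; rewrite -dual_actM mulVg dual_act1. Qed.

Lemma dual_act_refl s theta : dualV theta -> theta (alpha s) = 0 ->
  dual_act (val s) theta = theta.
Proof.
move=> th th0; apply/funext => v; rewrite /dual_act (cox_inv WS (set_val_in s)).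
have [c ->] := srefl_comb WS s v.
have := th 1 v (c *: alpha s); rewrite mul1r => ->.
by have := th c (alpha s) 0; rewrite addr0 (scalar0 th) addr0 th0 mulr0 => ->; rewrite addr0.
Qed.

Lemma dualV_act w theta : dualV theta -> dualV (dual_act w theta).
Proof. by move=> th k u v; rewrite /dual_act (geom_act_lin WS) th. Qed.

Lemma dual_act_gen J theta w : J `<=` S -> dualV theta ->
  (forall s, J (val s) -> theta (alpha s) = 0) -> gen J w ->
  dual_act w theta = theta.
Proof.
move=> JS th thJ; apply: (_ : gen J `<=` [set w | dual_act w theta = theta]).
apply: gen_sub => [|a Ja] /=; last first.
  have := @dual_act_refl (exist _ a (mem_set (JS _ Ja)) : S) theta th.
  by apply; apply: thJ.
split=> [|x y /= xth yth|x /= xth]; first exact: dual_act1.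
  by rewrite dual_actM yth.
by rewrite -{1}xth dual_actK.
Qed.

Lemma dual_act_faceM J x y : J `<=` S -> gen J y ->
  dual_act (x * y)%g @` faceC J = dual_act x @` (@faceC R W S J).
Proof.
move=> JS Jy; apply: eq_imagel => theta [th _ thJ].
by rewrite dual_actM (dual_act_gen JS th thJ Jy).
Qed.

Definition zeros theta : set W := [set val s | s in [set s : S | theta (alpha s) = 0]].

(** Induction on the length of [w]. A left descent [s] of [w] makes [w^-1 alpha_s] nonpositive,
    which forces [phi] to vanish on [alpha_s]; then [s] fixes [phi], and the shorter element [s * w]
    also carries [theta] to [phi]. *)
Lemma dominant_stab theta phi w : dualV theta ->
  (forall s, 0 <= theta (alpha s)) -> (forall s, 0 <= phi (alpha s)) ->
  dualV phi -> dual_act w theta = phi -> theta = phi /\ gen (zeros theta) w.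
Proof.
move=> th th0 ph0 ph; have [n] := ubnP (len w).
elim: n w => // n IHn w; rewrite ltnS => wn wth.
have [w1|/eqP w1] := eqVneq w 1%g.
  by split; [rewrite -wth w1 dual_act1|rewrite w1; exact: gen1].
have [|s0 Ss0 ws0] := descent_exists WS (w := w^-1%g).
  by move=> /(congr1 (fun x => x^-1)%g); rewrite invgK invg1.
pose s : S := exist _ s0 (mem_set Ss0).
have {ws0} ws : (len (w^-1 * val s)%g < len w^-1%g)%N by exact: ws0.
have ps : phi (alpha s) = 0.
  apply/eqP; rewrite eq_le ph0 andbT -oppr_ge0 -wth /dual_act -scalarN //.
  by apply: scalar_ge0 => //; apply: root_npos.
have sinv := cox_inv WS (set_val_in s).
have sw : (len (val s * w)%g < n)%N.
  by rewrite -(length_inv WS) invgM sinv; apply: leq_trans wn; rewrite -(length_inv WS w).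
have [|e sw_gen] := IHn _ sw; first by rewrite dual_actM wth dual_act_refl.
split=> //; have -> : w = (val s * (val s * w))%g by rewrite -{1}sinv mulKg.
by apply: genM => //; apply: sub_gen; exists s => //=; rewrite e.
Qed.

Lemma faceC_ge0 J theta s : faceC J theta -> 0 <= theta (alpha s).
Proof.
by move=> [_ th0 thJ]; have [/thJ ->|/th0/ltW] := pselect (J (val s)).
Qed.

Lemma zeros_faceC J theta : J `<=` S -> faceC J theta -> zeros theta = J.
Proof.
move=> JS [_ th0 thJ]; apply/seteqP; split=> [_ [s /= ths <-]|a Ja].
  by apply: contrapT => /th0; rewrite ths ltxx.
exists (exist _ a (mem_set (JS _ Ja)) : S) => //=; exact: thJ.
Qed.

Lemma faceC_nonempty J : exists theta, @faceC R W S J theta.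
Proof.
exists (lin_of (fun s : S => if `[< J (val s) >] then 0 else 1)).
split=> [|s Js|s Js]; first exact: lin_of_scalar.
  by rewrite lin_of_root; case: asboolP => // _; rewrite ltr01.
by rewrite lin_of_root; case: asboolP.
Qed.

(** Adding a positive multiple of the functional equal to 1 on all simple roots moves [theta] into
    [chamberC]; let the multiple tend to 0. *)
Lemma faceC_closure J : faceC J `<=` @chamberC_closure R W S.
Proof.
move=> theta thJ; have [th _ _] := thJ; split=> // B nB.
pose delta : geomV R S -> R := lin_of (fun=> 1).
pose f (e : R) : {ptws geomV R S -> R} := fun v => theta v + e * delta v.
have cf : f @ 0^'+ --> theta.
  apply: ptws_cvg => v; apply: cvg_at_right_filter.
  rewrite -[X in _ --> X]addr0 -[X in _ --> _ + X](mul0r (delta v)).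
  by apply: cvgD; [exact: cvg_cst|apply: cvgM; [exact: cvg_id|exact: cvg_cst]].
have /filter_ex[e [e0 fe]] : \forall e \near 0^'+, 0 < e /\ B (f e).
  by apply: filterI; [exact: nbhs_right_gt|exact: cf].
exists (f e); split=> //; split=> [k u v|s].
  by rewrite /f /delta th (lin_of_scalar (fun=> 1)) mulrDr mulrDr mulrCA addrACA.
by rewrite /f /delta lin_of_root mulr1 ltr_wpDl // (faceC_ge0 _ thJ).
Qed.

End DualAction.

(** * Core cosets *)

Lemma finite_card_sub_eq (T : choiceType) (A B : set T) :
  finite_set A -> A `<=` B -> (B #= A)%card -> A = B.
Proof.
move=> Afin AB BA; have Bfin : finite_set B.
  by apply: card_le_finite Afin; move: BA; rewrite card_eq_le => /andP[].
have /finite_setP[n An] := Afin.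
apply: fset_set_inj => //; apply/eqP; rewrite eqEfcard (card_fset_set An).
rewrite (card_fset_set (card_eq_trans BA An)) leqnn andbT.
by rewrite -(fset_set_sub Afin Bfin).
Qed.

Lemma psumr_seq_eq0 (R : realType) (T : eqType) (q : seq T) (F : T -> R) i :
  (forall j, 0 <= F j)%R -> (\sum_(j <- q) F j = 0)%R -> i \in q -> F i = 0%R.
Proof.
move=> F0 /eqP; rewrite psumr_eq0 // => /allP Fq /Fq.
by move=> /implyP/(_ isT)/eqP.
Qed.

(** * Minimal coset representatives *)

Section MinimalElements.
Local Open Scope group_scope.
Variables (W : groupType) (S : set W).
Hypothesis WS : coxeter_system S.
Implicit Types (w x y : W) (I J p : set W).
Local Notation len := (length S).

(** Every generating step of the Bruhat order raises the length, so elements of least length are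
    minimal. *)
Lemma bruhat_length x y : bruhat S x y -> x = y \/ (len x < len y)%N.
Proof.
elim=> [a b [t _ [_ ab]]|a|a b c _ [->|ab] _ [<-|bc]]; [by right|by left|by left| | |].
- by right.
- by right.
- by right; apply: ltn_trans bc.
Qed.

(** An element of least length in [p] meets the condition in [min_elt], so [xget] does not fall back
    on its default. *)
Lemma min_eltP I J p : double_cosets I J p ->
  p (min_elt S p) /\ forall y, p y -> bruhat S y (min_elt S p) -> y = min_elt S p.
Proof.
move=> pIJ; rewrite /min_elt; apply: (@xgetPex _ 1
  [set x | p x /\ forall y, p y -> bruhat S y x -> y = x]).
have [w pw] : exists w, p w.
  case: pIJ => w ->; exists w; exists 1; first exact: gen1.
  by exists 1; [exact: gen1|rewrite mul1g mulg1].
have ex : exists n, `[< exists2 x, p x & len x = n >].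
  by exists (len w); apply/asboolP; exists w.
have [n /asboolP[x px xn] nmin] := ex_minnP ex.
exists x; split=> // y py /bruhat_length[//|]; rewrite xn ltnNge => /negP[].
by apply: nmin; apply/asboolP; exists y.
Qed.

(** Otherwise [x * s] would be an element of the coset strictly below the minimal element [x]. *)
Lemma min_elt_ascent I J p s : J `<=` S -> double_cosets I J p -> J s ->
  (len (min_elt S p) < len (min_elt S p * s))%N.
Proof.
move=> JS pIJ Js; have [px xmin] := min_eltP pIJ; set x := min_elt S p in px xmin *.
rewrite (length_ltn WS _ (JS _ Js)); apply/negP => lt.
have xsx : x * s = x.
  apply: xmin.
    rewrite (double_cosetE pIJ px); exists 1; first exact: gen1.
    by exists s; [exact: sub_gen|rewrite mul1g].
  apply: rt_step; exists s; last by rewrite (cox_mulK WS _ (JS _ Js)).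
  by exists 1, s; split; [exact: JS|rewrite mul1g invg1 mulg1].
by move: lt; rewrite xsx ltnn.
Qed.

End MinimalElements.

(** * The correspondence between core cosets and chambers *)

Section CoreCosets.
Local Open Scope ring_scope.
Variables (R : realType) (W : groupType) (S : set W).
Hypothesis WS : coxeter_system S.
Implicit Types (s t r : S) (u v : geomV R S) (w x y : W) (I J : set W).
Implicit Types theta phi : {ptws geomV R S -> R}.

Local Notation rho := (@geom_act R W S).
Local Notation alpha := (@sroot R W S).

(** For [s = x t x^-1] with [t] in [J], the reflection [t] negates [x^-1 alpha_s] but preserves
    [phi], so [phi] vanishes there. *)
Lemma coset_face_Cham I J p : finitary S J -> double_cosets I J p ->
  core S I J p -> Cham R S I (coset_face R S J p).
Proof.
move=> [JS _] pIJ Icore; split; last first.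
  exists (min_elt S p), J; split=> //.
  rewrite card_eq_sym /core in Icore *; rewrite Icore.
  by apply: inj_card_eq => a b _ _ /mulIg/mulgI.
move=> _ [phi phJ <-]; split.
  by exists (min_elt S p) => //; exists phi => //; exact: faceC_closure phJ.
move=> s /=; rewrite {1}Icore => -[t0 Jt0 ts]; rewrite /dual_act.
set x := min_elt S p in ts *; have {}ts : (x * t0 * x^-1)%g = val s := ts.
have [phd _ phi0] := phJ.
have fix_t v : phi (rho t0 v) = phi v.
  have := dual_act_gen WS JS phd phi0 (sub_gen Jt0).
  move=> /(congr1 (fun f : {ptws _ -> _} => f (rho t0 v))).
  by rewrite /dual_act (geom_actK WS) => ->.
have e : rho t0 (rho x^-1%g (alpha s)) = - rho x^-1%g (alpha s).
  rewrite -(geom_actN WS) -(srefl_self R WS) -!(geom_actM WS) -ts.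
  by rewrite !mulgA mulVg mul1g.
have := fix_t (rho x^-1%g (alpha s)); rewrite e scalarN // => /eqP.
by rewrite eqNr => /eqP.
Qed.

Lemma geom_act_coef w v q : mcoeff q (rho w v) =
  \sum_(t <- msupp v) mcoeff t v * mcoeff q (rho w (alpha t)).
Proof.
pose th (u : geomV R S) : R := mcoeff q (rho w u).
apply: (@scalar_sum _ _ _ th) => k u u'.
by rewrite /th (geom_act_lin WS) mcoeffD mcoeffZ.
Qed.

Lemma nneg_act w J v : (forall t, J (val t) -> nneg (rho w (alpha t))) ->
  nneg v -> (forall t, ~ J (val t) -> mcoeff t v = 0) -> nneg (rho w v).
Proof.
move=> wJ v0 vJ q; rewrite geom_act_coef; apply: sumr_ge0 => t _.
have [Jt|/vJ->] := pselect (J (val t)); last by rewrite mul0r.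
by apply: mulr_ge0 => //; apply: wJ.
Qed.

(* A simple root s in I is an extremal ray of the nonnegative cone, hence is
   hit by one of the nonnegative vectors w alpha_t whose cone contains it. *)
Lemma nneg_conj_simple w J s :
  (forall t, J (val t) -> nneg (rho w (alpha t))) ->
  nneg (rho w^-1%g (alpha s)) ->
  (forall t, ~ J (val t) -> mcoeff t (rho w^-1%g (alpha s)) = 0) ->
  exists2 t : S, J (val t) & (w * val t * w^-1)%g = val s.
Proof.
move=> wJ; set b := rho w^-1%g (alpha s) => b0 bJ.
have [t bt] : exists t, mcoeff t b <> 0.
  apply: contrapT => nb; apply: (@root_neq0 R W S WS w^-1%g s).
  apply: geomV_ext => t; rewrite mcoeff0; apply: contrapT => bt.
  by apply: nb; exists t.
have Jt : J (val t) by apply: contrapT => /bJ.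
exists t => //; apply: (root_prop_conj WS (c := mcoeff s (rho w (alpha t)))).
apply: geomV_ext => q; rewrite gcoeffZ mcoeff_root.
have [<-|sq] := eqVneq s q; first by rewrite mulr1.
(* As [w] sends [b] to [alpha s], the coefficient at [q] is a vanishing sum of nonnegative terms, so
   each term is 0. *)
rewrite mulr0; have := geom_act_coef w b q.
rewrite {1}/b (geom_actVK WS) mcoeff_root (negbTE sq) => /esym sum0.
have /eqP : mcoeff t b * mcoeff q (rho w (alpha t)) = 0.
  apply: (psumr_seq_eq0 _ sum0) => [r|]; last by rewrite -mcoeff_neq0; apply/eqP.
  have [Jr|/bJ->] := pselect (J (val r)); last by rewrite mul0r.
  by apply: mulr_ge0; [exact: b0|exact: wJ].
rewrite mulf_eq0 => /orP[/eqP bt0|/eqP->]; last by [].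
by case: (bt bt0).
Qed.

Lemma Cham_coset_face I X : finitary S I -> Cham R S I X ->
  exists2 Jp, SCcore S I Jp & coset_face R S Jp.1 Jp.2 = X.
Proof.
move=> [IS Ifin] [XI [w0 [J [JS JI XE]]]].
pose p : set W := [set a * w0 * b | a in gen I & b in gen J]%g.
have pIJ : double_cosets I J p by exists w0.
have [pw _] := min_eltP S pIJ; set w := min_elt S p in pw.
have [a Ia [b Jb wE]] := pw.
(* [W_J] fixes [faceC J] pointwise, and [W_I] fixes [X] pointwise because [X] lies on the walls of
   [I]; hence the minimal [w] also yields [X]. *)
have wX : dual_act w @` faceC J = X.
  rewrite -wE (dual_act_faceM R WS _ JS Jb) XE.
  apply: eq_imagel => phi phJ; rewrite (dual_actM WS).
  have [_ th0] : Tits_cone_at I (dual_act w0 phi).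
    by apply: XI; rewrite XE; exists phi.
  apply: (dual_act_gen WS IS _ th0 Ia).
  by apply: dualV_act => //; case: phJ.
have w_up t : J (val t) -> nneg (rho w (alpha t)).
  by move=> Jt; apply: (root_nneg R WS); exact: (min_elt_ascent WS JS pIJ Jt).
have [phi phJ] := @faceC_nonempty R W S J.
have [phd ph0 _] := phJ.
have ph_ge0 t : 0 <= phi (alpha t) by exact: faceC_ge0 phJ.
have phi_root s : I (val s) -> phi (rho w^-1%g (alpha s)) = 0.
  move=> Is; have [_] : Tits_cone_at I (dual_act w phi).
    by apply: XI; rewrite -wX; exists phi.
  exact.
(* If [w^-1 alpha_s] were nonpositive, its support would lie in [J] because [phi] vanishes on it;
   applying [w] would make the negative of [alpha_s] nonnegative. *)
have w_down s : I (val s) -> nneg (rho w^-1%g (alpha s)).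
  move=> Is; have [//|Nneg] := root_sign R WS w^-1%g s; exfalso.
  have NJ t : ~ J (val t) -> mcoeff t (- rho w^-1%g (alpha s)) = 0.
    move=> Jt; apply: (scalar_eq0 phd) => //; last exact: ph0.
    by rewrite scalarN // phi_root // oppr0.
  have := nneg_act w_up Nneg NJ; rewrite (geom_actN WS) (geom_actVK WS).
  by move=> /(_ s); rewrite gcoeffN mcoeff_root eqxx oppr_ge0 ler10.
have supp s t : I (val s) -> ~ J (val t) -> mcoeff t (rho w^-1%g (alpha s)) = 0.
  move=> Is Jt; apply: (scalar_eq0 phd) => //; last exact: ph0.
  - exact: w_down.
  - exact: phi_root.
have I_eq : I = [set w * s * w^-1 | s in J]%g.
  apply: finite_card_sub_eq.
  - by apply: sub_finite_set Ifin; exact: sub_gen.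
  - move=> s0 Is0; pose s : S := exist _ s0 (mem_set (IS _ Is0)).
    have [t Jt ts] := nneg_conj_simple w_up (w_down s Is0) (fun t => @supp s t Is0).
    by exists (val t).
  - by apply: card_eq_trans JI; apply: inj_card_eq => x y _ _ /mulIg/mulgI.
exists (J, p) => //; split=> //=; split=> //.
(* [W_J] lies in a conjugate of the finite group [W_I]. *)
apply: (@sub_finite_set _ _ [set w^-1 * c * w | c in gen I]%g); last first.
  exact: finite_image.
move=> c Jc; exists (w * c * w^-1)%g; last by rewrite !mulgA mulVg mul1g mulgVK.
apply: gen_conj Jc => d Jd; apply: sub_gen; rewrite I_eq; exact: imageP.
Qed.

(** For [phi] in [faceC J], the element [y^-1 * x] takes [phi] into [faceC J']. By [dominant_stab]
    it fixes [phi], so [J = J'], and it lies in [W_J]. *)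
Lemma coset_face_inj I Jp Jp' : SCcore S I Jp -> SCcore S I Jp' ->
  coset_face R S Jp.1 Jp.2 = coset_face R S Jp'.1 Jp'.2 -> Jp = Jp'.
Proof.
case: Jp Jp' => [J p] [J' p'] [/= [JS _] pIJ _] [/= [JS' _] pIJ' _].
rewrite /coset_face; have [px _] := min_eltP S pIJ; have [py _] := min_eltP S pIJ'.
set x := min_elt S p in px *; set y := min_elt S p' in py * => xy.
have [phi phJ] := @faceC_nonempty R W S J.
have [psi psJ e] : (dual_act y @` faceC J') (dual_act x phi).
  by rewrite -xy; exists phi.
have psE : dual_act (y^-1 * x)%g phi = psi.
  by rewrite (dual_actM WS) -e (dual_actK WS).
have [phd _ _] := phJ; have [psd _ _] := psJ.
have [phs yx] := dominant_stab WS phd (fun s => faceC_ge0 s phJ)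
  (fun s => faceC_ge0 s psJ) psd psE.
have JJ' : J = J' by rewrite -(zeros_faceC JS phJ) -(zeros_faceC JS' psJ) phs.
move: yx; rewrite (zeros_faceC JS phJ) => yx; rewrite -JJ' in pIJ' *; congr (_, _).
(* It remains to see that [x] lies in [p'], being [y] times an element of [W_J]. *)
rewrite (double_cosetE pIJ px); apply/esym/(double_cosetE pIJ').
rewrite (double_cosetE pIJ' py); exists 1%g; first exact: gen1.
by exists (y^-1 * x)%g => //; rewrite mul1g mulgA mulgV mul1g.
Qed.

End CoreCosets.

Theorem proposition9p2 (R : realType) (W : groupType) (S : set W)
    (WS : coxeter_system S) (I : set W) (finI : finitary S I) :
  set_bij (SCcore S I) (Cham R S I)
    (fun Jp : set W * set W => coset_face R S Jp.1 Jp.2).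
Proof.
split=> [Jp [Jfin pIJ pcore]|Jp Jp' /set_mem Jp0 /set_mem Jp0'|X XI].
- exact: coset_face_Cham.
- exact: (coset_face_inj WS Jp0 Jp0').
- by have [Jp Jp0 <-] := Cham_coset_face WS finI XI; exists Jp.
Qed.
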